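(* Let $C$ and $C_1$ be cycles, with $C$ of non-zero radius (that is, $\det C\neq0$), and let $C_2=C\overline{C}_1C$ be the reflection of $C_1$ in $C$. Let $C_o$ be any cycle orthogonal to both $C$ and $C_1$, and let $Z_1$ and $Z_2$ be the two cycles (possibly with complex coordinates) which are orthogonal to $C$, to $C_o$ and to themselves (that is, the intersection points of $C$ and $C_o$). Assume that $\langle C_1,Z_1\rangle\ne0$ and $\langle C_1,Z_2\rangle\neq0$. Then $$\langle C_1,C_2;Z_1,Z_2\rangle=1 .$$
   Context: A cycle is a point $(k,l,n,m)$ of the real projective space $P\mathbb{R}^3$; it stands for the equation $k(x^2+y^2)-2lx-2ny+m=0$ in $\mathbb{R}^2$ (the solution set may be empty). With $L=l+\mathrm{i}n$ it is represented, up to a non-zero scalar, by the matrix $$C=\begin{pmatrix}\overline{L}&-m\\ k&-L\end{pmatrix}.$$ The bar over a matrix denotes entrywise complex conjugation. The cycles product is $\langle C,C_1\rangle=-\operatorname{tr}(C\overline{C}_1)=km_1+k_1m-2ll_1-2nn_1$; two cycles are orthogonal if their product is $0$; a cycle is self-orthogonal if $\langle Z,Z\rangle=0$ (zero radius cycle, i.e. a point). For cycles with complex coordinates $(k,l,n,m)$ the product is given by the same expression $km_1+k_1m-2ll_1-2nn_1$ (bilinear extension). The reflection of a cycle $C_1$ in a cycle $C$ is the cycle with matrix $C\overline{C}_1C$. The cycles cross ratio of four cycles is $$\langle C_1,C_2;C_3,C_4\rangle=\frac{\langle C_1,C_3\rangle}{\langle C_1,C_4\rangle}:\frac{\langle C_2,C_3\rangle}{\langle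 C_2,C_4\rangle}=\frac{\langle C_1,C_3\rangle\langle C_2,C_4\rangle}{\langle C_1,C_4\rangle\langle C_2,C_3\rangle}$$ when $\langle C_1,C_4\rangle\langle C_2,C_3\rangle\ne0$; it does not depend on the choice of the homogeneous coordinates of the cycles. *)

(* Defs.v *)
From HB Require Import structures.
From mathcomp Require Import all_boot all_order all_algebra.
From mathcomp Require Import reals complex.
From mathcomp Require Import ring.

Set Implicit Arguments.
Unset Strict Implicit.
Unset Printing Implicit Defensive.

Import Order.TTheory GRing.Theory Num.Theory.
Local Open Scope ring_scope.
Local Open Scope complex_scope.

(* Homogeneous coordinates (k, l, n, m) of a cycle.  A point of the projective
   space is a class for [same_cycle].  The value of [cycle_prod] depends on the
   representatives, its vanishing and the value of [cross_ratio] do not. *)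
Record hcycle (K : fieldType) := Cycle {
  ck : K; cl : K; cn : K; cm : K;
  cycle_neq0 : [|| ck != 0, cl != 0, cn != 0 | cm != 0]
}.

Definition same_cycle (K : fieldType) (C D : hcycle K) : Prop :=
  exists2 t : K, t != 0 &
    [/\ ck D = t * ck C, cl D = t * cl C, cn D = t * cn C & cm D = t * cm C].

Definition cycle_prod (K : fieldType) (C D : hcycle K) : K :=
  ck C * cm D + ck D * cm C - 2 * cl C * cl D - 2 * cn C * cn D.

Definition cycle_orth (K : fieldType) (C D : hcycle K) : Prop :=
  cycle_prod C D = 0.

(* Division is total, with x / 0 = 0: the value is meaningful when
   <C1, C4> <C2, C3> != 0, and it is 0 otherwise (see [cross_ratio_neq0]). *)
Definition cross_ratio (K : fieldType) (C1 C2 C3 C4 : hcycle K) : K :=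
  (cycle_prod C1 C3 / cycle_prod C1 C4) / (cycle_prod C2 C3 / cycle_prod C2 C4).

Definition cycle_mx (R : realType) (C : hcycle R) : 'M[R[i]]_2 :=
  let L := cl C +i* cn C in
  \matrix_(i, j)
    if i == 0 then (if j == 0 then L^* else - (cm C)%:C)
              else (if j == 0 then (ck C)%:C else - L).

Definition conj_mx (R : realType) (M : 'M[R[i]]_2) : 'M[R[i]]_2 :=
  map_mx (@conjc R) M.

(* The matrix of a cycle is only defined up to a non-zero scalar. *)
Definition is_reflection (R : realType) (C C1 C2 : hcycle R) : Prop :=
  exists2 t : R[i], t != 0 &
    cycle_mx C2 = t *: (cycle_mx C *m conj_mx (cycle_mx C1) *m cycle_mx C).

Lemma complexify_neq0 (R : realType) (C : hcycle R) :
  [|| (ck C)%:C != 0, (cl C)%:C != 0, (cn C)%:C != 0 | (cm C)%:C != 0].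
Proof.
have E (x : R) : (x%:C == 0) = (x == 0) by rewrite eq_complex /= eqxx andbT.
by rewrite !E cycle_neq0.
Qed.

Definition complexify (R : realType) (C : hcycle R) : hcycle R[i] :=
  Cycle (complexify_neq0 C).

Lemma cycle_prod_tr (R : realType) (C D : hcycle R) :
  (cycle_prod C D)%:C = - \tr (cycle_mx C *m conj_mx (cycle_mx D)).
Proof.
rewrite /mxtrace !big_ord_recl big_ord0 !mxE !big_ord_recl !big_ord0 !mxE /=.
by apply/eqP; rewrite eq_complex /= /cycle_prod; apply/andP; split; apply/eqP;
  ring.
Qed.

Lemma cycle_prod_complexify (R : realType) (C D : hcycle R) :
  cycle_prod (complexify C) (complexify D) = (cycle_prod C D)%:C.
Proof.
by rewrite /cycle_prod /= !rmorphB rmorphD !rmorphM rmorph_nat.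
Qed.

Lemma cross_ratio_neq0 (K : fieldType) (C1 C2 C3 C4 : hcycle K) :
  cross_ratio C1 C2 C3 C4 != 0 -> cycle_prod C1 C4 * cycle_prod C2 C3 != 0.
Proof.
by rewrite /cross_ratio !mulf_eq0 !invr_eq0 !mulf_eq0 !invr_eq0 !negb_or
  => /andP[/andP[_ ->] /andP[-> _]].
Qed.

Lemma same_cycle_prod (K : fieldType) (C D C' D' : hcycle K) :
  same_cycle C C' -> same_cycle D D' ->
  exists2 t : K, t != 0 & cycle_prod C' D' = t * cycle_prod C D.
Proof.
move=> [s s0 [Ek El En Em]] [t t0 [Fk Fl Fn Fm]].
exists (s * t); first by rewrite mulf_neq0.
by rewrite /cycle_prod Ek El En Em Fk Fl Fn Fm; ring.
Qed.

Lemma same_cycle_cross_ratio (K : fieldType)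
    (C1 C2 C3 C4 D1 D2 D3 D4 : hcycle K) :
  same_cycle C1 D1 -> same_cycle C2 D2 ->
  same_cycle C3 D3 -> same_cycle C4 D4 ->
  cross_ratio D1 D2 D3 D4 = cross_ratio C1 C2 C3 C4.
Proof.
move=> [a a0 [? ? ? ?]] [b b0 [? ? ? ?]] [c c0 [? ? ? ?]] [d d0 [? ? ? ?]].
have E (C D C' D' : hcycle K) s t :
    ck C' = s * ck C -> cl C' = s * cl C -> cn C' = s * cn C ->
    cm C' = s * cm C -> ck D' = t * ck D -> cl D' = t * cl D ->
    cn D' = t * cn D -> cm D' = t * cm D ->
    cycle_prod C' D' = s * t * cycle_prod C D.
  by rewrite /cycle_prod => -> -> -> -> -> -> -> ->; ring.
rewrite /cross_ratio (E C1 C3 D1 D3 a c) // (E C1 C4 D1 D4 a d) //.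
rewrite (E C2 C3 D2 D3 b c) // (E C2 C4 D2 D4 b d) // !invfM !invrK.
set x := (cycle_prod C1 C4)^-1; set y := (cycle_prod C2 C3)^-1.
by field; rewrite ?a0 ?b0 ?c0 ?d0.
Qed.

Lemma det_cycle_mx (R : realType) (C : hcycle R) :
  \det (cycle_mx C) = (ck C * cm C - cl C ^+ 2 - cn C ^+ 2)%:C.
Proof.
rewrite (expand_det_row _ 0) !big_ord_recl big_ord0 /cofactor.
rewrite !det_mx11 !mxE /= expr0 expr1; apply/eqP.
by rewrite eq_complex /=; apply/andP; split; apply/eqP; ring.
Qed.

Lemma is_reflection_exists (R : realType) (C C1 : hcycle R) :
  \det (cycle_mx C) != 0 -> exists C2, is_reflection C C1 C2.
Proof.
move=> dC.
pose M := cycle_mx C *m conj_mx (cycle_mx C1) *m cycle_mx C.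
pose d := ck C * cm C - cl C ^+ 2 - cn C ^+ 2.
pose p := cycle_prod C C1.
have d0 : d != 0.
  by apply: contraNneq dC => d0; rewrite det_cycle_mx -/d d0.
(* C2 = d C1 - p C *)
pose f x y : R := d * x - p * y.
have nz : [|| f (ck C1) (ck C) != 0, f (cl C1) (cl C) != 0,
             f (cn C1) (cn C) != 0 | f (cm C1) (cm C) != 0].
  apply: contraT; rewrite !negb_or !negbK /f !subr_eq0.
  move=> /and4P[/eqP Ek /eqP El /eqP En /eqP Em].
  have: d * p = 2 * d * p.
    rewrite {1}/p /cycle_prod.
    transitivity (ck C * (d * cm C1) + (d * ck C1) * cm C
      - 2 * cl C * (d * cl C1) - 2 * cn C * (d * cn C1)); first by ring.
    by rewrite Ek El En Em /d; ring.
  move/eqP; rewrite -subr_eq0 (_ : _ - _ = - (d * p)); last by ring.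
  rewrite oppr_eq0 mulf_eq0 (negPf d0) /= => /eqP p0.
  move: Ek El En Em; rewrite p0 !mul0r.
  move=> /eqP Ek /eqP El /eqP En /eqP Em; move: (cycle_neq0 C1).
  by move: Ek El En Em; rewrite !mulf_eq0 (negPf d0) /= => -> -> -> ->.
exists (Cycle nz), 1; first exact: oner_neq0.
apply/matrixP => i j; rewrite !mxE !big_ord_recl !big_ord0 !mxE.
rewrite !big_ord_recl !big_ord0 !mxE.
case: i => [[|[|//]] hi]; case: j => [[|[|//]] hj] /=; apply/eqP;
  rewrite eq_complex /= /f /d /p /cycle_prod; apply/andP; split; apply/eqP;
  ring.
Qed.

(* Main.v *)
Require Import Defs.
From mathcomp Require Import all_boot all_order all_algebra.
From mathcomp Require Import reals complex.
From mathcomp Require Import ring.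

Import Order.TTheory GRing.Theory Num.Theory.
Local Open Scope ring_scope.
Local Open Scope complex_scope.

(** The matrices of cycles satisfy the Clifford relations
    [C \bar C = - det C] and, by polarisation,
    [C \bar D + D \bar C = - <C, D>].  Moving [C] through [\bar C_1] turns the
    reflection into a linear combination ([reflection_mxE]):
    [C \bar C_1 C = det C * C_1 - <C, C_1> * C].
    Pairing with a cycle [Z] orthogonal to [C] kills the second term, so that
    [<C_2, Z> = s <C_1, Z>] with one and the same factor [s <> 0] for all such
    [Z] ([reflection_prod]).  Both [Z_1] and [Z_2] are orthogonal to [C], and
    the factor cancels in the cross ratio. *)

Lemma same_cycle_refl {K : fieldType} (C : hcycle K) : same_cycle C C.
Proof. by exists 1; rewrite ?oner_neq0 // !mul1r. Qed.

(** For real [Z] this is [conj_mx (cycle_mx Z)].  For complex [Z] it is the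
    complex linear extension of that expression in the coordinates, hence no
    coordinate of [Z] is conjugated. *)
Definition dual_mx {R : realType} (Z : hcycle R[i]) : 'M[R[i]]_2 :=
  \matrix_(i, j)
    if i == 0 then (if j == 0 then cl Z + 'i * cn Z else - cm Z)
              else (if j == 0 then ck Z else - (cl Z - 'i * cn Z)).

(** The trace form of the product makes it linear in the matrix of the first
    cycle, which is how the reflection is given. *)
Lemma cycle_prod_dual {R : realType} (C : hcycle R) (Z : hcycle R[i]) :
  cycle_prod (complexify C) Z = - \tr (cycle_mx C *m dual_mx Z).
Proof.
rewrite /mxtrace !big_ord_recl big_ord0 !mxE !big_ord_recl !big_ord0 !mxE /=.
rewrite /cycle_prod /=.
case: (ck Z) (cl Z) (cn Z) (cm Z) => [? ?] [? ?] [? ?] [? ?].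
by apply/eqP; rewrite eq_complex /=; apply/andP; split; apply/eqP; ring.
Qed.

Lemma cycle_mx_clifford {R : realType} (C D : hcycle R) :
  cycle_mx C *m conj_mx (cycle_mx D) + cycle_mx D *m conj_mx (cycle_mx C)
    = - ((cycle_prod C D)%:C)%:M.
Proof.
apply/matrixP => i j; rewrite !mxE !big_ord_recl !big_ord0 !mxE /cycle_prod.
case: i => [[|[|//]] hi]; case: j => [[|[|//]] hj] /=; apply/eqP;
  by rewrite eq_complex /=; apply/andP; split; apply/eqP; ring.
Qed.

Lemma conj_cycle_mxK {R : realType} (C : hcycle R) :
  conj_mx (cycle_mx C) *m cycle_mx C = - (\det (cycle_mx C))%:M.
Proof.
rewrite det_cycle_mx.
apply/matrixP => i j; rewrite !mxE !big_ord_recl !big_ord0 !mxE.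
case: i => [[|[|//]] hi]; case: j => [[|[|//]] hj] /=; apply/eqP;
  by rewrite eq_complex /=; apply/andP; split; apply/eqP; ring.
Qed.

(** The matrix form of the vector reflection formula, obtained by replacing
    [C \bar D] with [- <C, D> - D \bar C]. *)
Lemma reflection_mxE {R : realType} (C D : hcycle R) :
  cycle_mx C *m conj_mx (cycle_mx D) *m cycle_mx C
    = \det (cycle_mx C) *: cycle_mx D - (cycle_prod C D)%:C *: cycle_mx C.
Proof.
have /eqP := cycle_mx_clifford C D; rewrite -subr_eq0 opprK -addrA addr_eq0.
move=> /eqP ->; rewrite mulNmx mulmxDl -mulmxA conj_cycle_mxK.
by rewrite mulmxN mul_mx_scalar mul_scalar_mx opprD opprK.
Qed.

(** On the orthogonal complement of [C], reflection in [C] acts on products as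
    a scalar. *)
Lemma reflection_prod {R : realType} {C C1 C2 : hcycle R} :
  \det (cycle_mx C) != 0 -> is_reflection C C1 C2 ->
  exists2 s : R[i], s != 0 &
    forall Z : hcycle R[i], cycle_orth Z (complexify C) ->
      cycle_prod (complexify C2) Z = s * cycle_prod (complexify C1) Z.
Proof.
move=> dC [t t0 C2E]; exists (t * \det (cycle_mx C)); first by rewrite mulf_neq0.
move=> Z ZC; have CZ : \tr (cycle_mx C *m dual_mx Z) = 0.
  apply/eqP; rewrite -oppr_eq0 -cycle_prod_dual -ZC; apply/eqP.
  by rewrite /cycle_prod; ring.
rewrite !cycle_prod_dual C2E reflection_mxE -scalemxAl mulmxBl -!scalemxAl.
by rewrite mxtraceZ raddfB /= !mxtraceZ CZ mulr0 subr0 mulrN mulrA.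
Qed.

Theorem mainTheorem2 (R : realType) (C C1 C2 Co : hcycle R) (Z1 Z2 : hcycle R[i])
    (C_radius : \det (cycle_mx C) != 0)
    (C2_reflection : is_reflection C C1 C2)
    (Co_C : cycle_orth Co C)
    (Co_C1 : cycle_orth Co C1)
    (Z1Z2 : forall Z : hcycle R[i],
       [/\ cycle_orth Z (complexify C), cycle_orth Z (complexify Co)
         & cycle_orth Z Z]
       <-> same_cycle Z1 Z \/ same_cycle Z2 Z)
    (C1_Z1 : cycle_prod (complexify C1) Z1 != 0)
    (C1_Z2 : cycle_prod (complexify C1) Z2 != 0) :
  cross_ratio (complexify C1) (complexify C2) Z1 Z2 = 1.
Proof.
have [Z1C _ _] := (Z1Z2 Z1).2 (or_introl (same_cycle_refl Z1)).
have [Z2C _ _] := (Z1Z2 Z2).2 (or_intror (same_cycle_refl Z2)).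
have [s s0 C2Z] := reflection_prod C_radius C2_reflection.
rewrite /cross_ratio (C2Z _ Z1C) (C2Z _ Z2C).
by field; rewrite s0 C1_Z1 C1_Z2.
Qed.
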